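(* Let $h,\lambda>0$. The general solution of the difference inequality $$y(t+h)-\lambda y(t)\le 0$$ is given by $$y(t)=\lambda^{t/h}\mu(t)+\sum_{s=1}^{\lfloor t\rfloor_h}\lambda^{s-1}q(t-sh),$$ where $q$ is any non-positive real-valued function and $\mu\in\mathbb{P}_h$.
   Context: Functions are real-valued functions of a real variable. $\mathbb{P}_h$ denotes the set of all functions $\mu:\mathbb{R}\to\mathbb{R}$ with $\mu(x+h)=\mu(x)$. For $h>0$, $\lfloor t\rfloor_h\in\mathbb{Z}$ is defined by $\lfloor t\rfloor_h=n$ where $t=nh+r$, $n\in\mathbb{Z}$, $0\le r<h$; equivalently $\lfloor t\rfloor_h=\lfloor t/h\rfloor$. A sum whose upper limit is smaller than its lower limit equals $0$.
   Formalization: That every solution has the displayed form is stated for t ≥ 0 only (inequality and formula both on t ≥ 0), since for t < 0 the empty sum forces y(t+h) = λy(t) and the claim fails, e.g. y(t) = −t with h = λ = 1; that the formula solves the inequality is stated for all real t. *)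

(* Defs.v *)
From mathcomp Require Import all_boot all_order all_algebra.
From mathcomp Require Import all_classical all_reals all_analysis.

Set Implicit Arguments.
Unset Strict Implicit.
Unset Printing Implicit Defensive.

Import Order.TTheory GRing.Theory Num.Theory.
Local Open Scope ring_scope.

Definition floorh (R : realType) (h t : R) : int := Num.floor (t / h).

Lemma floorhP (R : realType) (h t : R) (n : int) : 0 < h ->
  floorh h t = n <-> exists r : R, t = n%:~R * h + r /\ 0 <= r < h.
Proof.
move=> h0; split=> [<-|[r [-> /andP[r0 rh]]]].
- exists (t - (floorh h t)%:~R * h); split; first by rewrite addrC subrK.
  have : (floorh h t)%:~R <= t / h < (floorh h t + 1)%:~R.
    by rewrite floor_le /= floorD1_gt.
  by rewrite ler_pdivlMr // ltr_pdivrMr // intrD mulrDl mul1r subr_ge0 ltrBlDl.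
- apply: floor_def; rewrite ler_pdivlMr // ltr_pdivrMr // intrD mulrDl mul1r.
  by rewrite lerDl r0 ltrD2l rh.
Qed.

(* [sum_from1 n F] is F 1 + ... + F n; it is 0 when n <= 0. *)
Definition sum_from1 (R : realType) (n : int) (F : nat -> R) : R :=
  if n is Posz m then \sum_(1 <= s < m.+1) F s else 0.

Definition sol_formula (R : realType) (h lambda : R) (mu q : R -> R) (t : R) : R :=
  lambda `^ (t / h) * mu t
  + sum_from1 (floorh h t) (fun s => lambda ^+ s.-1 * q (t - s%:R * h)).

(* Main.v *)
Require Import Defs.
From mathcomp Require Import all_boot all_order all_algebra.
From mathcomp Require Import all_classical all_reals all_analysis.
From mathcomp Require Import zify ring.

Import Order.TTheory GRing.Theory Num.Theory.
Local Open Scope ring_scope.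

(** For any h-periodic mu, [sol_formula h lambda mu q] solves
    y(t + h) = lambda y(t) + q(t) for t >= 0 (and the homogeneous equation for
    t < 0).  Conversely, given y, put q(t) := y(t + h) - lambda y(t) for t >= 0
    and choose mu periodic so that the formula agrees with y on [0, h); since
    both sides then satisfy the same recurrence, they agree for all t >= 0. *)

Section DifferenceEquation.
Context (R : realType) (h : R) (h_gt0 : 0 < h).

Lemma floorhDh (t : R) : floorh h (t + h) = floorh h t + 1.
Proof.
rewrite /floorh mulrDl divff ?gt_eqF // floorDrz; last exact: rpred1.
by rewrite floor1.
Qed.

Lemma floorh_ge0 (t : R) : (0 <= floorh h t) = (0 <= t).
Proof. by rewrite /floorh floor_ge_int pmulr_lge0 ?invr_gt0. Qed.

(** Induction on the quotient of [t] by [h]: subtracting [h] lowers it by one and keeps the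
    remainder, so finitely many steps lead down to [[0, h)]. *)
Lemma shift_ind (P : R -> Prop) :
  (forall t, 0 <= t < h -> P t) -> (forall t, 0 <= t -> P t -> P (t + h)) ->
  forall t, 0 <= t -> P t.
Proof.
move=> P0 PS t t_ge0.
have [n] : exists n : nat, floorh h t = n.
  by move: t_ge0; rewrite -floorh_ge0; case: floorh => // n _; exists n.
elim: n t t_ge0 => [|n IHn] t t_ge0 /(floorhP _ _ h_gt0)[r [tE r_itv]].
  by apply: P0; rewrite tE mul0r add0r.
case/andP: (r_itv) => r_ge0 _.
have tE' : t - h = n%:~R * h + r by rewrite tE -addn1 PoszD intrD; ring.
have t'_ge0 : 0 <= t - h by rewrite tE' addr_ge0 // mulr_ge0 ?ler0n // ltW.
rewrite -(subrK h t); apply: (PS) => //; apply: IHn => //.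
by apply/(floorhP _ _ h_gt0); exists r.
Qed.

Context (lambda : R) (lambda_gt0 : 0 < lambda).

Lemma powR_divDh (t : R) :
  lambda `^ ((t + h) / h) = lambda * lambda `^ (t / h).
Proof.
rewrite mulrDl divff ?gt_eqF // powRD; last by rewrite (gt_eqF lambda_gt0) implybT.
by rewrite powRr1 ?ltW // mulrC.
Qed.

(** At [t + h] the term [s = 1] is [q t], and the term [s + 1] is [lambda] times the term [s] at
    [t]. *)
Lemma sum_from1_shift (q : R -> R) (t : R) (n : int) :
  sum_from1 (n + 1) (fun s => lambda ^+ s.-1 * q (t + h - s%:R * h)) =
  lambda * sum_from1 n (fun s => lambda ^+ s.-1 * q (t - s%:R * h))
  + (if 0 <= n then q t else 0).
Proof.
case: n => [n|[|n]].
- rewrite -PoszD addn1 /= big_nat_recl // expr0 !mul1r addrK addrC; congr +%R.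
  rewrite big_add1 /= mulr_sumr big_add1 /=; apply: eq_bigr => s _.
  by rewrite exprS mulrA; congr (_ * q _); rewrite -addn1 natrD; ring.
(* For [n = -1] the left side is a sum up to 0, empty as a big operator; below -1 both sides take
   the default value 0. *)
- by rewrite /= big_geq // mulr0 addr0.
- have -> : Negz n.+1 + 1 = Negz n by lia.
  by rewrite /= mulr0 addr0.
Qed.

Lemma sol_formulaDh (mu q : R -> R) (t : R) : periodic mu h ->
  sol_formula h lambda mu q (t + h) =
  lambda * sol_formula h lambda mu q t + (if 0 <= t then q t else 0).
Proof.
move=> mu_per; rewrite /sol_formula floorhDh sum_from1_shift floorh_ge0.
by rewrite powR_divDh mu_per mulrDr mulrA addrA.
Qed.

Lemma sol_formula_itv0h (mu q : R -> R) (t : R) : 0 <= t < h ->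
  sol_formula h lambda mu q t = lambda `^ (t / h) * mu t.
Proof.
move=> t_itv; rewrite /sol_formula.
have -> : floorh h t = 0.
  by apply/(floorhP _ _ h_gt0); exists t; rewrite mul0r add0r.
by rewrite /= big_geq // addr0.
Qed.

(** The representative of [t] modulo [h] in [[0, h)]; composing any function with it yields an
    [h]-periodic one. *)
Definition remh (t : R) : R := t - (floorh h t)%:~R * h.

Lemma remhDh : periodic remh h.
Proof. by move=> t; rewrite /remh floorhDh intrD; ring. Qed.

Lemma remh_id (t : R) : 0 <= t < h -> remh t = t.
Proof.
move=> t_itv; rewrite /remh.
have -> : floorh h t = 0.
  by apply/(floorhP _ _ h_gt0); exists t; rewrite mul0r add0r.
by rewrite mul0r subr0.
Qed.

Lemma sol_formula_complete (y : R -> R) :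
  (forall t, 0 <= t -> y (t + h) - lambda * y t <= 0) ->
  exists mu q : R -> R,
    [/\ periodic mu h, (forall t, q t <= 0)
      & forall t, 0 <= t -> y t = sol_formula h lambda mu q t].
Proof.
move=> y_sol.
(* The power of [lambda] cancels the factor [lambda^(t/h)] of the formula on [[0, h)]. *)
pose mu t := lambda `^ (- (remh t / h)) * y (remh t).
(* The inequality for [y] is known only for [t >= 0], while [q] must be non-positive everywhere;
   hence the value 0 at negative [t]. *)
pose q t := if 0 <= t then y (t + h) - lambda * y t else 0.
have mu_per : periodic mu h by move=> t; rewrite /mu remhDh.
exists mu, q; split=> // [t|].
  by rewrite /q; case: ifPn => // /y_sol.
apply: shift_ind => [t t_itv|t t_ge0 yt].
  rewrite sol_formula_itv0h // /mu remh_id // powRN mulVKf //.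
  by rewrite gt_eqF // powR_gt0.
by rewrite sol_formulaDh // -yt /q t_ge0 [RHS]addrC subrK.
Qed.

End DifferenceEquation.

Theorem theorem3p3 (R : realType) (h lambda : R) (h_gt0 : 0 < h) (lambda_gt0 : 0 < lambda) :
  (forall mu q : R -> R, periodic mu h -> (forall t : R, q t <= 0) ->
     forall t : R,
       sol_formula h lambda mu q (t + h) - lambda * sol_formula h lambda mu q t <= 0)
  /\
  (forall y : R -> R,
     (forall t : R, 0 <= t -> y (t + h) - lambda * y t <= 0)
     <->
     exists mu q : R -> R,
       [/\ periodic mu h,
           (forall t : R, q t <= 0)
         & forall t : R, 0 <= t -> y t = sol_formula h lambda mu q t]).
Proof.
have sound (mu q : R -> R) : periodic mu h -> (forall t, q t <= 0) -> forall t,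
    sol_formula h lambda mu q (t + h) - lambda * sol_formula h lambda mu q t <= 0.
  (* By the recurrence the difference is [q t] or 0, according to the sign of [t]. *)
  move=> mu_per q_le0 t; rewrite sol_formulaDh // addrC addKr.
  by case: ifP.
split=> // y; split; first exact: sol_formula_complete.
case=> mu [q [mu_per q_le0 yE]] t t_ge0.
by rewrite !yE ?addr_ge0 ?(ltW h_gt0) //; apply: sound.
Qed.
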